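(* Let $n>1$ and $d>1$ be integers and let $K$ be an algebraically closed field. The resultant ideal $I_{d,n}\lhd K[a_{i,j}]_{1\le i\le n,\,0\le j\le d}$ is generated by all $(d+k)\times(d+k)$ minors of the matrices $M_k$ for $1\le k\le d$.
   Context: The $a_{i,j}$ ($1\le i\le n$, $0\le j\le d$) are independent indeterminates over $K$, and $f_i(x)=a_{i,0}x^d+a_{i,1}x^{d-1}+\cdots+a_{i,d}$ for $1\le i\le n$. The resultant ideal $I_{d,n}$ is obtained from the ideal $\langle f_1(x),\dots,f_n(x)\rangle\subset K[a_{i,j}][x]$ by eliminating $x$, i.e. $I_{d,n}=\langle f_1,\dots,f_n\rangle\cap K[a_{i,j}]$. For $1\le k\le d$, $M_k$ is the $nk\times(d+k)$ matrix whose rows are indexed by pairs $(i,j)$, $1\le i\le k$, $1\le j\le n$, ordered lexicographically from top to bottom (so there are $k$ blocks of $n$ rows each), whose columns are indexed by $1,\dots,d+k$, and whose entry in row $(i,j)$ and column $c$ is $a_{j,c-i}$ if $0\le c-i\le d$ and $0$ otherwise. (Thus each block is the $n\times(d+1)$ matrix $(a_{j,l})$, shifted one column to the right relative to the block above it.) If $nk<d+k$, then $M_k$ has no $(d+k)\times(d+k)$ minors. *)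

(* Defs.v *)
From mathcomp Require Import all_boot all_order all_algebra.
From mathcomp Require Import mpoly.

Set Implicit Arguments.
Unset Strict Implicit.
Unset Printing Implicit Defensive.

Import GRing.Theory.
Local Open Scope ring_scope.

Definition ideal_gen (R : comNzRingType) (S : R -> Prop) (g : R) : Prop :=
  exists (m : nat) (c s : 'I_m -> R),
    (forall t, S (s t)) /\ g = \sum_(t < m) c t * s t.

Definition coef_ring (K : closedFieldType) (n d : nat) : comNzRingType :=
  {mpoly K[n * d.+1]}.

(* The variables are numbered by the entries of an n x (d+1) matrix. *)
Definition avar (K : closedFieldType) (n d : nat) (i : 'I_n) (j : 'I_d.+1) :
    coef_ring K n d :=
  'X_(mxvec_index i j).

(* The index j counts down from the leading term: a_{i,j} multiplies x^(d-j). *)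
Definition genpoly (K : closedFieldType) (n d : nat) (i : 'I_n) :
    {poly coef_ring K n d} :=
  \sum_(j < d.+1) (avar K i j)%:P * 'X^(d - j).

Definition resultant_ideal (K : closedFieldType) (n d : nat)
    (g : coef_ring K n d) : Prop :=
  ideal_gen (fun p => exists i : 'I_n, p = genpoly K d i) g%:P.

(* Indices start at 0, which leaves the difference c - i unchanged; the guard
   makes the truncated subtraction exact and [inord] faithful. *)
Definition Mentry (K : closedFieldType) (n d k : nat)
    (i : 'I_k) (j : 'I_n) (c : 'I_(d + k)) : coef_ring K n d :=
  if (i <= c <= i + d)%N then avar K j (inord (c - i)) else 0.

(* [mxvec] lists the pairs (i, j) lexicographically, so the row at
   [mxvec_index i j] is row j of block i. *)
Definition Mmatrix (K : closedFieldType) (n d k : nat) :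
    'M[coef_ring K n d]_(k * n, d + k) :=
  \matrix_(r, c) mxvec (\matrix_(i < k, j < n) Mentry K i j c) 0 r.

(* All columns are used; a strictly increasing [h] selects the rows, and no
   such [h] exists when k * n < d + k. *)
Definition maximal_minor (K : closedFieldType) (n d k : nat)
    (g : coef_ring K n d) : Prop :=
  exists h : 'I_(d + k) -> 'I_(k * n),
    (forall u v : 'I_(d + k), (u < v)%N -> (h u < h v)%N) /\
    g = \det (rowsub h (Mmatrix K n d k)).

(* Main.v *)
Require Import Defs.
From mathcomp Require Import all_boot all_order all_fingroup all_algebra.
From mathcomp Require Import mpoly.
From mathcomp Require Import zify ring.

(* Weight the variable a_{i,l} by a function that is concave in l and whose
   slopes in l increase with i, and call a monomial bad if, for every l < d, it
   is divisible by a_{i,l} a_{i',l+1} for some i < i'.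
   - The variables witnessing that a monomial is bad form a chain which splits
     into consecutive runs of increasing l.  Placing the r-th run in block r of
     M_k makes their product the diagonal of a maximal minor, and by the
     rearrangement inequality it is strictly heavier than all other terms.
   - Let m be a monomial of top weight in an element g of the resultant ideal,
     without any pair a_{i,l} a_{i',l+1}, i < i'.  Every family
     f_i = (x - t) * (b_{i,0} x^(d-1) + ...) is a zero of g.  Give t the weight
     of a slope at l in a well-chosen row i0, and the b's accordingly: in top
     weight the coordinates of f_i become independent variables, except that
     some coordinates at l and l+1, not occurring in m, vanish, and one variable
     stands for both coordinates l and l+1 of row i0.  The weight separates the
     monomials that are thus identified, so the coefficient of m in g is 0.
   Hence the top weight of an element of the resultant ideal is carried by bad
   monomials, and subtracting multiples of minors lowers it. *)

Set Implicit Arguments.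
Unset Strict Implicit.
Unset Printing Implicit Defensive.

Import Order.TTheory GRing.Theory Num.Theory.
Local Open Scope ring_scope.


(** * Closure properties of generated ideals *)

Section IdealGen.
Variables (R : comNzRingType) (S : R -> Prop).

Lemma ideal_gen_mem g : S g -> ideal_gen S g.
Proof.
move=> Sg; exists 1, (fun=> 1), (fun=> g); split=> //.
by rewrite big_ord1 mul1r.
Qed.

Lemma ideal_gen0 : ideal_gen S 0.
Proof. by exists 0, (fun=> 0), (fun=> 0); split=> [[]|]; rewrite ?big_ord0. Qed.

Lemma ideal_genD g1 g2 : ideal_gen S g1 -> ideal_gen S g2 -> ideal_gen S (g1 + g2).
Proof.
move=> [m1 [c1 [s1 [Ss1 ->]]]] [m2 [c2 [s2 [Ss2 ->]]]].
pose glue (f1 : 'I_m1 -> R) (f2 : 'I_m2 -> R) t :=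
  match split t with inl u => f1 u | inr u => f2 u end.
exists (m1 + m2)%N, (glue c1 c2), (glue s1 s2); split=> [t|].
  by rewrite /glue; case: (split t).
rewrite big_split_ord; congr (_ + _); apply: eq_bigr => t _ /=; rewrite /glue.
  by rewrite (unsplitK (inl _ t)).
by rewrite (unsplitK (inr _ t)).
Qed.

Lemma ideal_genM a g : ideal_gen S g -> ideal_gen S (a * g).
Proof.
move=> [m [c [s [Ss ->]]]]; exists m, (fun t => a * c t), s; split=> //.
by rewrite mulr_sumr; apply: eq_bigr => t _; rewrite mulrA.
Qed.

Lemma ideal_gen_sum (I : Type) (r : seq I) (P : pred I) (F : I -> R) :
  (forall i, P i -> ideal_gen S (F i)) -> ideal_gen S (\sum_(i <- r | P i) F i).
Proof.
by move=> SF; apply: big_ind => //; [apply: ideal_gen0 | apply: ideal_genD].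
Qed.

End IdealGen.

(** * Coefficients at a prescribed degree bound *)

Section TopCoefficient.
Variable S : comNzRingType.

(** Coefficients are read off at degree bounds rather than at actual degrees, so zero divisors and
    vanishing top coefficients do no harm. *)
Lemma top_coefM (p q : {poly S}) a b :
    (size p <= a.+1)%N -> (size q <= b.+1)%N ->
  (size (p * q)%R <= (a + b).+1)%N /\ (p * q)`_(a + b) = p`_a * q`_b.
Proof.
move=> sp sq; split.
  apply: leq_trans (size_polyMleq _ _) _.
  by lia.
have lt_a : (a < (a + b).+1)%N by rewrite ltnS leq_addr.
rewrite coefM (bigD1 (Ordinal lt_a)) //= addKn big1 ?addr0 // => i.
rewrite -val_eqE /= => ne_ia; case: (ltnP a i) => [lt_ai|le_ia].
  by rewrite nth_default ?mul0r // (leq_trans sp).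
rewrite [q`__]nth_default ?mulr0 // (leq_trans sq) //.
by move: (ltn_ord i); lia.
Qed.

Lemma top_coefX (p : {poly S}) a k : (size p <= a.+1)%N ->
  (size (p ^+ k)%R <= (k * a).+1)%N /\ (p ^+ k)`_(k * a) = p`_a ^+ k.
Proof.
move=> sp; elim: k => [|k [IHs IHc]].
  by rewrite mul0n expr0 size_poly1 coef1.
by rewrite !exprS mulSn -IHc; apply: top_coefM.
Qed.

Lemma top_coef_prod (I : Type) (r : seq I) (F : I -> {poly S}) (a : I -> nat) :
    (forall i, size (F i) <= (a i).+1)%N ->
  (size (\prod_(i <- r) F i)%R <= (\sum_(i <- r) a i).+1)%N /\
  (\prod_(i <- r) F i)`_(\sum_(i <- r) a i) = \prod_(i <- r) (F i)`_(a i).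
Proof.
move=> sF; elim: r => [|i r [IHs IHc]].
  by rewrite !big_nil size_poly1 coef1.
by rewrite !big_cons -IHc; apply: top_coefM.
Qed.

End TopCoefficient.

(** * Weights of monomials and the filtration by weight *)

Section Weight.
Variables (N : nat) (w : 'I_N -> nat).

Definition mwt (m : 'X_{1..N}) : nat := \sum_v m v * w v.

Lemma mwtD m1 m2 : mwt (m1 + m2)%MM = (mwt m1 + mwt m2)%N.
Proof. by rewrite /mwt -big_split; apply: eq_bigr => v _; rewrite mnmDE mulnDl. Qed.

Lemma mwt0 : mwt 0%MM = 0%N.
Proof. by rewrite /mwt big1 // => v _; rewrite mnm0E. Qed.

Lemma mwt1 v : mwt U_(v)%MM = w v.
Proof.
rewrite /mwt (bigD1 v) //= mnm1E eqxx mul1n big1 ?addn0 // => u ne_uv.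
by rewrite mnm1E eq_sym (negPf ne_uv).
Qed.

Lemma mwt_sum (I : Type) (r : seq I) (P : pred I) (F : I -> 'X_{1..N}) :
  mwt (\sum_(i <- r | P i) F i)%MM = \sum_(i <- r | P i) mwt (F i).
Proof. exact: (big_morph _ mwtD mwt0). Qed.

Variable K : comNzRingType.

Definition below W (g : {mpoly K[N]}) := forall m, g@_m != 0 -> (mwt m < W)%N.

Lemma below0 W : below W 0.
Proof. by move=> m; rewrite mcoeff0 eqxx. Qed.

Lemma belowX W m : (mwt m < W)%N -> below W 'X_[m].
Proof. by move=> lt_mW u; rewrite mcoeffX; case: (m =P u) => [<-|_] //=; rewrite eqxx. Qed.

Lemma belowD W g1 g2 : below W g1 -> below W g2 -> below W (g1 + g2).
Proof.
move=> b1 b2 m; rewrite mcoeffD; case: (eqVneq g1@_m 0) => [->|/b1//].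
by rewrite add0r => /b2.
Qed.

Lemma belowZ W c g : below W g -> below W (c *: g).
Proof.
by move=> b m; rewrite mcoeffZ; case: (eqVneq g@_m 0) => [->|/b//]; rewrite mulr0 eqxx.
Qed.

Lemma belowN W g : below W g -> below W (- g).
Proof. by rewrite -scaleN1r; apply: belowZ. Qed.

Lemma below_sum W (I : Type) (r : seq I) (P : pred I) (F : I -> {mpoly K[N]}) :
  (forall i, P i -> below W (F i)) -> below W (\sum_(i <- r | P i) F i).
Proof. by move=> bF; apply: big_ind => //; [apply: below0 | apply: belowD]. Qed.

Lemma belowMX W m g : below W g -> below (W + mwt m) (g * 'X_[m]).
Proof.
rewrite {2}(mpolyE g) mulr_suml big_seq => bg; apply: below_sum => u u_g.
rewrite -scalerAl -mpolyXD; apply/belowZ/belowX.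
by rewrite mwtD ltn_add2r bg // -mcoeff_msupp.
Qed.

(** The image of a monomial [u] has degree at most [mwt u]; hence degree [W] sees only the heaviest
    monomials, and of each [h v] only the coefficient at [w v]. *)
Lemma coef_mmap_top (S : comNzRingType) (f : {rmorphism K -> S})
    (h : 'I_N -> {poly S}) W (g : {mpoly K[N]}) :
    (forall v, size (h v) <= (w v).+1)%N -> below W.+1 g ->
  (mmap (polyC \o f) h g)`_W =
    \sum_(u <- msupp g | mwt u == W) f g@_u * mmap1 (fun v => (h v)`_(w v)) u.
Proof.
move=> sh bg; rewrite /mmap coef_sum [RHS]big_mkcond !big_seq.
apply: eq_bigr => u; rewrite mcoeff_msupp => /bg; rewrite ltnS => le_uW.
rewrite /= coefCM.
have [su <-] : (size (mmap1 h u) <= (mwt u).+1)%N /\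
    (mmap1 h u)`_(mwt u) = mmap1 (fun v => (h v)`_(w v)) u.
  rewrite /mmap1 /mwt -(eq_bigr _ (fun v _ => (top_coefX (u v) (sh v)).2)).
  by apply: top_coef_prod => v; have [] := top_coefX (u v) (sh v).
case: eqP => [<-//|ne_uW]; rewrite nth_default ?mulr0 //.
by apply: leq_trans su _; rewrite ltn_neqAle le_uW andbT; apply/eqP.
Qed.

End Weight.


(** * Maximal minors lie in the resultant ideal *)

Lemma Mmatrix_index (K : closedFieldType) (n d k : nat) (i : 'I_k) (j : 'I_n)
    (c : 'I_(d + k)) :
  Mmatrix K n d k (mxvec_index i j) c = Mentry K i j c.
Proof. by rewrite mxE mxvecE mxE. Qed.

Lemma Mmatrix_mul_powers (K : closedFieldType) (n d k : nat) (i : 'I_k)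
    (j : 'I_n) :
  \sum_(c < d + k) (Mmatrix K n d k (mxvec_index i j) c)%:P * 'X^(d + k - c.+1)
    = 'X^(k - i.+1) * genpoly K d j.
Proof.
rewrite /genpoly mulr_sumr.
under eq_bigr do rewrite Mmatrix_index.
have lt_ik := ltn_ord i.
have lt_c (l : 'I_d.+1) : (l + i < d + k)%N by move: (ltn_ord l); lia.
rewrite (bigID (fun c : 'I_(d + k) => (i <= c <= i + d)%N)) /= [X in _ + X]big1.
  rewrite addr0 (reindex_onto (fun l => Ordinal (lt_c l))
    (fun c : 'I_(d + k) => inord (c - i) : 'I_d.+1)) /=; last first.
    move=> c /andP[le_ic le_cid]; apply: val_inj; rewrite /= inordK; lia.
  apply: eq_big => [l|l _].
    by rewrite addnK inord_val eqxx andbT leq_addl addnC leq_add2l -ltnS ltn_ord.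
  rewrite /Mentry /= leq_addl addnC leq_add2l -ltnS ltn_ord addnC addnK inord_val.
  rewrite mulrCA -exprD; congr (_ * 'X^_).
  by move: (ltn_ord l); lia.
by move=> c /negPf nc; rewrite /Mentry nc mul0r.
Qed.

(** Cramer's rule: the last row of the adjugate combines the rows of the minor into its determinant
    times the last unit vector, and the last column is the one paired with ['X^0]. *)
Lemma maximal_minor_resultant (K : closedFieldType) (n d k : nat)
    (g : coef_ring K n d) :
  (0 < d + k)%N -> maximal_minor k g -> resultant_ideal g.
Proof.
move=> dk_gt0 [h [_ ->]]; rewrite /resultant_ideal; set A := rowsub h _.
have lt_last : ((d + k).-1 < d + k)%N by rewrite prednK.
pose last := Ordinal lt_last.
have -> : (\det A)%:P =
    \sum_r (\adj A last r)%:P * \sum_c (A r c)%:P * 'X^(d + k - c.+1).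
  under [RHS]eq_bigr do rewrite mulr_sumr.
  rewrite exchange_big /=.
  rewrite (eq_bigr (fun c => ((\adj A *m A) last c)%:P * 'X^(d + k - c.+1))).
    rewrite mul_adj_mx (bigD1 last) //= mxE eqxx prednK // subnn expr0 mulr1.
    by rewrite big1 ?addr0 // => c; rewrite mxE eq_sym => /negPf ->; rewrite mul0r.
  move=> c _; rewrite mxE rmorph_sum mulr_suml; apply: eq_bigr => r _ /=.
  by rewrite rmorphM mulrA.
apply: ideal_gen_sum => r _; apply: ideal_genM.
rewrite (eq_bigr (fun c => (Mmatrix K n d k (h r) c)%:P * 'X^(d + k - c.+1))).
  case/mxvec_indexP: (h r) => i j; rewrite Mmatrix_mul_powers.
  by apply/ideal_genM/ideal_gen_mem; exists j.
by move=> c _; rewrite !mxE.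
Qed.


(** * Lexicographic numbering of the rows *)

Lemma index_allpairs_pair (T1 T2 : eqType) (s : seq T1) (t : seq T2) x y :
    x \in s -> y \in t ->
  index (x, y) [seq (a, b) | a <- s, b <- t] = (index x s * size t + index y t)%N.
Proof.
move=> + ty; elim: s => //= a s IHs; rewrite inE index_cat.
have [<- _|ne_xa /= sx] := eqVneq x a.
  by rewrite map_f // index_map // => ? ? [].
have /negPf-> : (x, y) \notin [seq (a, b) | b <- t].
  by apply/mapP=> -[b _ [/eqP]]; rewrite (negPf ne_xa).
by rewrite IHs // size_map mulSn addnA.
Qed.

Lemma val_mxvec_index k n (i : 'I_k) (j : 'I_n) :
  mxvec_index i j = (i * n + j)%N :> nat.
Proof.
rewrite /mxvec_index /=.
have -> : enum_rank (i, j) = index (i, j) (enum {: 'I_k * 'I_n}) :> nat.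
  rewrite -[X in index X](nth_enum_rank (i, j) (i, j)) index_uniq ?enum_uniq //.
  by rewrite -cardE ltn_ord.
rewrite enumT unlock /= /prod_enum index_allpairs_pair ?mem_enum //.
by rewrite !index_enum_ord size_enum_ord.
Qed.

(** * Strict rearrangement inequality *)

Lemma perm_neq1_desc m (s : 'S_m) : s != 1%g -> exists r, (s r < r)%N.
Proof.
move=> ne_s1; apply/existsP; apply: contraR ne_s1; rewrite negb_exists => /forallP s_ge.
(* If no [s r] lies below [r], these differences are exact, and they cancel because [s] only
   permutes the summands. *)
have : \sum_(r < m) (s r - r)%N == 0%N.
  rewrite -(eqn_add2r (\sum_(r < m) r)) add0n -big_split /=.
  rewrite (eq_bigr (fun r => nat_of_ord (s r))) => [|r _].
    by rewrite [X in _ == X](reindex_inj (@perm_inj _ s)).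
  by rewrite subnK // leqNgt.
rewrite sum_nat_eq0 => /forallP s_le; apply/eqP/permP => r; apply: val_inj.
have := s_le r; have := s_ge r; rewrite perm1 /=; lia.
Qed.

Section Rearrangement.
Variables (m : nat) (theta : nat -> int).
Hypothesis theta_mono : forall r r', (r < r' < m)%N -> theta r < theta r'.

Let F x := \sum_(0 <= y < x) theta y.

Let F_up r k : (r + k < m)%N -> theta r * k%:Z <= F (r + k) - F r.
Proof.
elim: k => [|k IHk] lt_m; first by rewrite addn0; lia.
have le_theta : theta r <= theta (r + k)%N.
  by case: k {IHk} lt_m => [|k] ?; rewrite ?addn0 // ltW // theta_mono; lia.
have /IHk : (r + k < m)%N by lia.
rewrite addnS /F [X in _ -> _ <= X - _]big_nat_recr //= => IH.
by rewrite -addn1 PoszD mulrDr mulr1 addrAC lerD.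
Qed.

Let F_down r k : (0 < k)%N -> (r + k < m)%N ->
  - (theta (r + k)%N * k%:Z) < F r - F (r + k).
Proof.
case: k => // k _; elim: k => [|k IHk] lt_m.
  rewrite addn1 /F big_nat_recr //=.
  by rewrite mulr1 opprD addNKr ltrN2 theta_mono // ltnSn -addn1.
have /IHk : (r + k.+1 < m)%N by lia.
rewrite [(r + k.+2)%N]addnS /F [X in _ -> _ < _ - X]big_nat_recr //= => IH.
have lt_theta : theta (r + k.+1)%N < theta (r + k.+1).+1 by apply: theta_mono; lia.
rewrite opprD addrA; apply: le_lt_trans (ltr_leD IH (lexx _)).
rewrite -opprD -{2}[theta (r + k.+1)%N]mulr1 -mulrDr -PoszD addn1 lerN2.
by rewrite ler_wpM2r // ltW // addnS.
Qed.

(* [F] is convex with slope [theta r] to the right of [r], so it lies above its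
   tangents; summing the tangent inequalities at [r] and [s r] gives the claim. *)
Lemma perm_rearrangement_lt (s : 'S_m) : s != 1%g ->
  \sum_(r < m) theta r * (s r)%:Z < \sum_(r < m) theta r * r%:Z.
Proof.
move=> /perm_neq1_desc[r0 lt_sr0].
have tangent_down (r : 'I_m) : (s r < r)%N ->
    theta r * (s r)%:Z - F (s r) < theta r * r%:Z - F r.
  move=> lt_r; have := @F_down (s r) (r - s r).
  rewrite (subnKC (ltnW lt_r)) subn_gt0 => /(_ lt_r (ltn_ord _)).
  rewrite -subzn ?(ltnW lt_r) // mulrBr.
  by move: (theta r * _) (theta r * _) (F _) (F _) => a b x y; lia.
have tangent (r : 'I_m) : theta r * (s r)%:Z - F (s r) <= theta r * r%:Z - F r.
  case: (leqP r (s r)) => [le_r|/tangent_down/ltW //].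
  have := @F_up r (s r - r); rewrite subnKC // => /(_ (ltn_ord _)).
  rewrite -subzn // mulrBr.
  by move: (theta r * _) (theta r * _) (F _) (F _) => a b x y; lia.
have: \sum_(r < m) (theta r * (s r)%:Z - F (s r)) < \sum_(r < m) (theta r * r%:Z - F r).
  rewrite (bigD1 r0) //= [X in _ < X](bigD1 r0) //=.
  by apply: ltr_leD; [apply: tangent_down | apply: ler_sum => r _].
rewrite !sumrB [X in _ < _ - X](reindex_inj (@perm_inj _ s)) /=.
by rewrite ltrD2r.
Qed.

End Rearrangement.


Lemma perm_rearrangement_ord m (theta : 'I_m -> int) (s : 'S_m) :
    (forall r r' : 'I_m, (r < r')%N -> theta r < theta r') -> s != 1%g ->
  \sum_r theta r * (s r)%:Z < \sum_r theta r * r%:Z.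
Proof.
move=> theta_mono ne_s1; pose t y := oapp theta 0 (insub y).
have tE (r : 'I_m) : t r = theta r by rewrite /t valK.
under eq_bigr do rewrite -tE.
under [ltRHS]eq_bigr do rewrite -tE.
apply: perm_rearrangement_lt => // r r' /andP[lt_rr' lt_r'm].
have lt_rm := ltn_trans lt_rr' lt_r'm.
by rewrite (tE (Ordinal lt_rm)) (tE (Ordinal lt_r'm)) theta_mono.
Qed.

(** * The weight and the heavy diagonal of a minor *)

(* The quadratic term makes the weight at [l = c - s] contribute [2 n s c], which
   with [2 i c] adds up to [2 (n s + i) c], where [n s + i] is the row index; the
   summand [2 n] only keeps the exponents [phi i l.+1 - T] below nonnegative. *)
Definition phi (n d i l : nat) : nat := (2 * n + n * (l * (2 * d - l)) + 2 * i * l)%N.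

Lemma phi_int n d i l : (l <= d)%N ->
  (phi n d i l)%:Z = 2 * n%:Z + n%:Z * (l%:Z * (2 * d%:Z - l%:Z)) + 2 * i%:Z * l%:Z.
Proof. by move=> le_ld; rewrite /phi !PoszD !PoszM -subzn ?PoszM; [ring | lia]. Qed.

Definition avar_weight (n d : nat) (v : 'I_(n * d.+1)) : nat :=
  mxvec (\matrix_(i < n, l < d.+1) phi n d i l) 0 v.

Lemma avar_weightE n d (i : 'I_n) (l : 'I_d.+1) :
  avar_weight (mxvec_index i l) = phi n d i l.
Proof. by rewrite /avar_weight mxvecE mxE. Qed.

Section HeavyDiagonal.
Variables (K : closedFieldType) (n d k : nat).
Variables (s : 'I_(d + k) -> 'I_k) (i : 'I_(d + k) -> 'I_n).
Hypothesis band : forall c, (s c <= c <= s c + d)%N.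
Hypothesis row_mono :
  forall c c' : 'I_(d + k), (c < c')%N -> (s c * n + i c < s c' * n + i c')%N.

(** If [t] is not [banded], truncated subtraction and [inord] make this monomial meaningless. *)
Let diag (t : 'S_(d + k)) : 'X_{1..n * d.+1} :=
  (\sum_c U_(mxvec_index (i c) (inord (t c - s c) : 'I_d.+1)))%MM.

Let banded (t : 'S_(d + k)) := [forall c, s c <= t c <= s c + d]%N.

(** With [l = t c - s c], the quadratic part of [phi] splits into a function of [s c], a function of
    [t c] and a mixed term. Permuting columns preserves the second sum, so [t] matters only through
    the last one. *)
Let mwt_diag t : banded t ->
  (mwt (@avar_weight n d) (diag t))%:Z =
    \sum_(c < d + k) (2 * n%:Z - n%:Z * (s c)%:Z * (2 * d%:Z + (s c)%:Z)
      - 2 * (i c)%:Z * (s c)%:Z)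
    + \sum_(c < d + k) n%:Z * c%:Z * (2 * d%:Z - c%:Z)
    + 2 * \sum_(c < d + k) ((s c)%:Z * n%:Z + (i c)%:Z) * (t c)%:Z.
Proof.
move=> /forallP bt; rewrite mwt_sum [X in _ + X + _](reindex_inj (@perm_inj _ t)) /=.
rewrite mulr_sumr -!big_split /= (big_morph Posz PoszD (erefl _)).
apply: eq_bigr => c _; have /andP[le_st le_td] := bt c.
rewrite mwt1 avar_weightE inordK ?phi_int; [|lia..].
by rewrite -subzn //; ring.
Qed.

Let prod_diag (t : 'S_(d + k)) :
  \prod_c Mmatrix K n d k (mxvec_index (s c) (i c)) (t c) =
    if banded t then 'X_[diag t] else 0.
Proof.
case: ifP => [/forallP bt|/negbT].
  rewrite (big_morph (fun m => 'X_[m]) (@mpolyXD _ _) (@mpolyX0 _ _)).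
  by apply: eq_bigr => c _; rewrite Mmatrix_index /Mentry bt.
rewrite negb_forall => /existsP[c /negPf ntc].
by rewrite (bigD1 c) //= Mmatrix_index /Mentry ntc mul0r.
Qed.

(** The row index [s c * n + i c] strictly increases with [c], so by rearrangement the identity
    gives the strictly heaviest term of the determinant. *)
Lemma heavy_diagonal_minor :
  exists2 D : coef_ring K n d, maximal_minor k D &
    below (@avar_weight n d) (mwt (@avar_weight n d) (diag 1)) (D - 'X_[diag 1]).
Proof.
pose h c := mxvec_index (s c) (i c).
exists (\det (rowsub h (Mmatrix K n d k))).
  by exists h; split=> // u v lt_uv; rewrite !val_mxvec_index row_mono.
have b1 : banded 1 by apply/forallP => c; rewrite perm1.
rewrite /determinant (bigD1 1%g) //= odd_perm1 mul1r.
under eq_bigr do rewrite mxE.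
rewrite prod_diag b1 [_ - _]addrC addKr; apply: below_sum => t ne_t1.
under eq_bigr do rewrite mxE.
rewrite prod_diag mulr_sign; case: (boolP (banded t)) => [bt|_]; last first.
  by rewrite oppr0 if_same; apply: below0.
have lt_t1 : (mwt (@avar_weight n d) (diag t) < mwt (@avar_weight n d) (diag 1))%N.
  rewrite -ltz_nat !mwt_diag // ltrD2l ltr_pM2l //.
  under [ltRHS]eq_bigr do rewrite perm1.
  apply: perm_rearrangement_ord => // r r' /row_mono; lia.
by case: (odd_perm t); [apply: belowN|]; apply: belowX.
Qed.

End HeavyDiagonal.


(** * Chains of variables in a bad monomial *)

Lemma mxvec_index_inj k n (i i' : 'I_k) (j j' : 'I_n) :
  mxvec_index i j = mxvec_index i' j' -> i = i' /\ j = j'.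
Proof. by move=> /cast_ord_inj/enum_rank_inj[-> ->]. Qed.

Section Chain.
Variables (n : nat) (occ : nat -> 'I_n -> bool).

(* Two consecutive letters of a chain lie in the same block of M_k when the
   letter increases, and in consecutive blocks when it is repeated. *)
Definition chain_step : rel (nat * 'I_n) := fun x y =>
  ((y.1 == x.1.+1) && (x.2 < y.2)%N) || (y.1 == x.1).

(** The chain is prolonged by the ascent at the next letter: one element suffices if that ascent
    starts in the row where the chain ends; otherwise its start is inserted as a repeated letter. So
    each letter adds one or two elements. *)
Lemma chain_exists j :
    (forall l, (l <= j)%N -> exists i i' : 'I_n, [/\ (i < i')%N, occ l i & occ l.+1 i']) ->
  exists (E : seq (nat * 'I_n)) (i0 p : 'I_n),
    [/\ path chain_step (0%N, i0) (rcons E (j.+1, p)),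
        uniq ((0%N, i0) :: rcons E (j.+1, p)),
        all (fun x => occ x.1 x.2) ((0%N, i0) :: rcons E (j.+1, p)),
        all (fun x => x.1 <= j)%N ((0%N, i0) :: E)
      & (j <= size E <= j + j)%N].
Proof.
elim: j => [|j IHj] ascents.
  have [//|i [i' [lt_ii' oi oi']]] := ascents 0%N.
  by exists [::], i, i'; split; rewrite /= ?oi ?oi' /chain_step ?lt_ii'.
have [l le_lj|E [i0 [p [pathE uniqE occE leE sizeE]]]] := IHj.
  by apply: ascents; lia.
have [//|i [i' [lt_ii' oi oi']]] := ascents j.+1.
(* Only the last element has a letter beyond [j], so new elements need to be compared with it
   alone. *)
have fresh l q : (j < l)%N -> (l, q) \in (0%N, i0) :: rcons E (j.+1, p) ->
    (l, q) = (j.+1, p).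
  move=> lt_jl; rewrite -rcons_cons mem_rcons inE => /orP[/eqP//|].
  by move=> /(allP leE) /=; lia.
have le_all : all (fun x : nat * 'I_n => x.1 <= j.+1)%N ((0%N, i0) :: rcons E (j.+1, p)).
  rewrite -rcons_cons all_rcons leqnn; apply: sub_all leE => x /=; lia.
have [eq_ip|ne_ip] := eqVneq i p.
  exists (rcons E (j.+1, p)), i0, i'; split=> //.
  - by rewrite rcons_path pathE last_rcons /chain_step /= eqxx -eq_ip lt_ii'.
  - rewrite -rcons_cons rcons_uniq uniqE andbT.
    by apply/negP => /fresh; rewrite ltnW // => /(_ isT) [] /eqP; rewrite gtn_eqF.
  - by rewrite -rcons_cons all_rcons occE oi'.
  - by rewrite size_rcons; lia.
have fresh_i : (j.+1, i) \notin (0%N, i0) :: rcons E (j.+1, p).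
  by apply/negP => /fresh -/(_ (ltnSn j)) [] /eqP; rewrite (negPf ne_ip).
exists (rcons (rcons E (j.+1, p)) (j.+1, i)), i0, i'; split=> //.
- by rewrite 2!rcons_path pathE !last_rcons /chain_step /= !eqxx lt_ii' orbT.
- rewrite -!rcons_cons rcons_uniq mem_rcons inE rcons_uniq uniqE fresh_i !andbT.
  rewrite xpair_eqE gtn_eqF //=; apply/negP => /fresh.
  by rewrite ltnW // => /(_ isT) [] /eqP; rewrite gtn_eqF.
- by rewrite -2!rcons_cons 2!all_rcons occE oi oi'.
- by rewrite -rcons_cons all_rcons leqnn le_all.
- by rewrite !size_rcons; lia.
Qed.

End Chain.

(** Element [c] of the chain goes to column [c] and block [c - lett c], where the matrix entry is
    its variable. As the chain has no repetition, the product of its variables divides [m]. *)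
Lemma bad_monomial_minor (K : closedFieldType) (n d : nat)
    (m : 'X_{1..n * d.+1}) :
    (0 < d)%N ->
    (forall l : nat, (l < d)%N -> exists i i' : 'I_n,
      [/\ (i < i')%N, (0 < m (mxvec_index i (inord l : 'I_d.+1)))%N
        & (0 < m (mxvec_index i' (inord l.+1 : 'I_d.+1)))%N]) ->
  exists (k : nat) (D : coef_ring K n d) (p : 'X_{1..n * d.+1}),
    [/\ (1 <= k <= d)%N, maximal_minor k D, (p <= m)%MM
      & below (@avar_weight n d) (mwt (@avar_weight n d) p) (D - 'X_[p])].
Proof.
case: d m => // d m _ ascents.
have [//|E0 [i0 [p [pathE uniqE occE leE sizeE]]]] := @chain_exists n
  (fun l i => 0 < m (mxvec_index i (inord l : 'I_d.+2)))%N d.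
set E := (0%N, i0) :: rcons E0 (d.+1, p) in uniqE occE.
have size_E : size E = (size E0).+2 by rewrite /= size_rcons.
pose lett c := (nth (0%N, i0) E c).1; pose row c := (nth (0%N, i0) E c).2.
have step c : (c.+1 < size E)%N ->
    (lett c.+1 = (lett c).+1 /\ (row c < row c.+1)%N) \/ lett c.+1 = lett c.
  move=> lt_c; have /pathP := pathE => /(_ (0%N, i0) c).
  rewrite ltnS in lt_c => /(_ lt_c) /orP[/andP[/eqP]|/eqP]; [left|right] => //.
have lett_le c : (c < size E)%N -> (lett c <= d.+1)%N.
  move=> /(mem_nth (0%N, i0)); rewrite -/(lett c) /E -rcons_cons mem_rcons inE.
  rewrite /lett; case/orP => [/eqP->//|/(allP leE)]; exact: leqW.
have lett_le_id c : (c < size E)%N -> (lett c <= c)%N.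
  elim: c => [//|c IHc] lt_c; have := IHc (ltnW lt_c); have := step c lt_c; lia.
have lett_last : lett (size E).-1 = d.+1.
  by rewrite /lett nth_last /= last_rcons.
(* The minor has one column per chain element. Here [d.+1] is the original degree, and the bounds on
   [size E0] become [1 <= k <= d.+1]. *)
pose k := (size E0 + 2 - d.+1)%N.
have dkE : (d.+1 + k)%N = size E by rewrite size_E /k; lia.
have shift_step c : (c.+1 < size E)%N ->
    ((c.+1 - lett c.+1 = c - lett c) /\ (row c < row c.+1))%N \/
    (c.+1 - lett c.+1 = (c - lett c).+1)%N.
  move=> lt_c; have := lett_le_id c (ltnW lt_c).
  by case: (step c lt_c) => [[-> lt_row]|->] ?; [left|right]; lia.
have shift_mono c c' : (c <= c')%N -> (c' < size E)%N ->
    (c - lett c <= c' - lett c')%N.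
  elim: c' => [|c' IHc'] le_cc' lt_c'; first by case: c le_cc'.
  move: le_cc'; rewrite leq_eqVlt => /orP[/eqP->//|le_cc'].
  have := IHc' le_cc' (ltnW lt_c'); have := shift_step c' lt_c'; lia.
have shift_lt c : (c < size E)%N -> (c - lett c < k)%N.
  move=> lt_c; have := @shift_mono c (size E).-1.
  by rewrite lett_last size_E /k; move: lt_c; rewrite size_E; lia.
have theta_mono c c' : (c < c')%N -> (c' < size E)%N ->
    ((c - lett c) * n + row c < (c' - lett c') * n + row c')%N.
  elim: c' => // c' IHc' lt_cc' lt_c'.
  have step_lt : ((c' - lett c') * n + row c' <
      (c'.+1 - lett c'.+1) * n + row c'.+1)%N.
    case: (shift_step c' lt_c') => [[-> lt_row]|->]; first by rewrite ltn_add2l.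
    by rewrite mulSn; move: (ltn_ord (row c')) (_ * n)%N => lt_n x; lia.
  move: lt_cc'; rewrite ltnS leq_eqVlt => /orP[/eqP->//|lt_cc'].
  by apply: ltn_trans step_lt; apply: IHc' => //; apply: ltnW.
have lt_ord (c : 'I_(d.+1 + k)) : (c < size E)%N by rewrite -dkE.
pose s (c : 'I_(d.+1 + k)) : 'I_k := Ordinal (shift_lt c (lt_ord c)).
have lett_s (c : 'I_(d.+1 + k)) : (c - s c)%N = lett c.
  by rewrite /s /= subKn // lett_le_id.
have [||D minorD belowD] := @heavy_diagonal_minor K n d.+1 k s (fun c => row c).
- by move=> c; have := lett_le_id c (lt_ord c); have := lett_le c (lt_ord c); rewrite /s /=; lia.
- by move=> c c' lt_cc'; apply: theta_mono.
exists k, D; eexists; split; [| exact: minorD | | exact: belowD].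
  by rewrite /k; lia.
apply/mnm_lepP => v; rewrite mnm_sumE.
under eq_bigr do rewrite perm1 lett_s mnm1E.
(* A variable has exponent at most 1 in the diagonal, and if it has exponent 1 it occurs in [m]. *)
have [/existsP[c /eqP <-]|] := boolP [exists c : 'I_(d.+1 + k),
    mxvec_index (row c) (inord (lett c) : 'I_d.+2) == v]; last first.
  rewrite negb_exists => /forallP nov; rewrite big1 // => c _.
  by rewrite (negPf (nov c)).
rewrite (bigD1 c) //= eqxx big1 => [|c' ne_c'c].
  by have := allP occE _ (mem_nth (0%N, i0) (lt_ord c)); rewrite addn0.
apply/eqP; rewrite eqb0; apply: contraNN ne_c'c => /eqP/mxvec_index_inj[eq_row].
move/(congr1 val); rewrite /= !inordK ?ltnS ?lett_le // => eq_lett.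
rewrite -val_eqE /= -(nth_uniq (0%N, i0) (lt_ord c') (lt_ord c) uniqE).
move: eq_row eq_lett; rewrite /row /lett.
by case: (nth _ E c') => a b; case: (nth _ E c) => a' b' /= -> ->.
Qed.


(** * Vanishing on families with a common root *)

(** The prescribed coefficients are those of ['X - x%:P] times the polynomial with coefficients
    [b i l], so all generic polynomials acquire the root [x]; evaluation there leaves the constant
    [g%:P] unchanged. *)
Lemma resultant_kernel (K : closedFieldType) (n d : nat) (S : comNzRingType)
    (f : {rmorphism coef_ring K n d -> S}) (x : S) (b : 'I_n -> nat -> S) g :
    (forall (i : 'I_n) (l : 'I_d.+1), f (avar K i l) =
      (if (l < d)%N then b i l else 0) - (if (0 < l)%N then x * b i l.-1 else 0)) ->
  resultant_ideal g -> f g = 0.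
Proof.
move=> fE [m [c [s [Ss gE]]]].
have <- : (map_poly f g%:P).[x] = f g by rewrite map_polyC hornerC.
rewrite gE rmorph_sum horner_sum big1 // => t _; have [i ->] := Ss t.
rewrite rmorphM hornerM /genpoly rmorph_sum horner_sum /=.
rewrite (eq_bigr (fun l : 'I_d.+1 =>
    (if (l < d)%N then b i l else 0) * x ^+ (d - l)
    - (if (0 < l)%N then x * b i l.-1 else 0) * x ^+ (d - l))); last first.
  move=> l _; rewrite rmorphM /= map_polyC map_polyXn hornerM hornerC hornerXn.
  by rewrite /= fE mulrBl.
(* The first sum loses its term at [d], the second its term at 0; after an index shift they
   cancel. *)
rewrite sumrB big_ord_recr /= ltnn mul0r addr0 [X in _ - X]big_ord_recl /= mul0r add0r.
rewrite -sumrB big1 ?mulr0 // => l _; rewrite ltn_ord /bump leq0n add1n /=.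
by rewrite -(subnSK (ltn_ord l)) exprS mulrCA mulrA subrr.
Qed.

(** * Slopes of the weight *)

Lemma phiS n d i l : (l < d)%N ->
  phi n d i l.+1 = (phi n d i l + (n * (2 * (d - l)).-1 + 2 * i))%N.
Proof.
move=> lt_ld; rewrite /phi -(subnKC lt_ld); move: (d - l.+1)%N => e.
have -> : (2 * (l.+1 + e) - l.+1 = l + 2 * e + 1)%N by lia.
have -> : (2 * (l.+1 + e) - l = l + 2 * e + 2)%N by lia.
have -> : ((2 * (l.+1 + e - l)).-1 = 2 * e + 1)%N by lia.
ring.
Qed.

(** Each step in [l] lowers the slope by [2 * n], more than a change of row can make up for. *)
Lemma phi_slope n d (i i' : 'I_n) l l' : (l < l' < d)%N ->
  (phi n d i' l'.+1 - phi n d i' l' < phi n d i l.+1 - phi n d i l)%N.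
Proof.
move=> /andP[lt_ll' lt_l'd]; rewrite !phiS ?(ltn_trans lt_ll') // !addKn.
have -> : (2 * (d - l)).-1 = ((2 * (d - l')).-1 + 2 + 2 * (l' - l).-1)%N by lia.
rewrite !mulnDr -!addnA ltn_add2l; have := ltn_ord i'.
by move: (n * _.-1)%N (n * 0)%N => c e; lia.
Qed.

Lemma leq_phi n d i l l' : (l <= l' <= d)%N -> (phi n d i l <= phi n d i l')%N.
Proof.
elim: l' => [|l' IHl'] /andP[]; first by case: l.
rewrite leq_eqVlt => /orP[/eqP->//|le_ll'] lt_l'd.
by rewrite phiS // (leq_trans _ (leq_addr _ _)) // IHl' // -ltnS le_ll' ltnW.
Qed.

(** * Top-weight monomials without an ascent at [j] *)

Section NoAscent.
Variables (K : closedFieldType) (n d : nat) (i0 : 'I_n) (j : nat).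
Hypothesis lt_jd : (j < d)%N.

Local Notation N := (n * d.+1)%N.
Local Notation R := {mpoly K[N]}.
Local Notation V i l := ('X_(mxvec_index i (inord l : 'I_d.+1)) : R).
Local Notation phi := (phi n d).

Let T := (phi i0 j.+1 - phi i0 j)%N.
(** The coordinate of row [i] that loses its own variable in top degree, since [d] coefficients
    [b i l] must account for [d.+1] coordinates. *)
Let cut (i : 'I_n) := if (i0 <= i)%N then j.+1 else j.

(** Coordinate [l] is to have its variable at degree [phi i l]: before the cut it comes from
    [b i l], after the cut from ['X^T * b i l.-1]. *)
Let b (i : 'I_n) (l : nat) : {poly R} :=
  if (l < cut i)%N then (V i l)%:P * 'X^(phi i l)
  else (V i l.+1)%:P * 'X^(phi i l.+1 - T).

(** The common root is [- 'X^T]; its sign turns the differences into sums. *)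
Let h (i : 'I_n) (l : nat) : {poly R} :=
  (if (l < d)%N then b i l else 0) + (if (0 < l)%N then 'X^T * b i l.-1 else 0).

Let lambda (i : 'I_n) (l : nat) : R :=
  if l != cut i then V i l else if i == i0 then V i j else 0.

Let top_monomial (S : nzRingType) (c : S) e a : (e <= a)%N ->
  (size (c%:P * 'X^e)%R <= a.+1)%N /\ (c%:P * 'X^e)`_a = c *+ (e == a).
Proof.
move=> le_ea; split; last by rewrite coefCM coefXn eq_sym mulr_natr.
apply: leq_trans (size_polyMleq _ _) _.
by rewrite size_polyXn addnS /= (leq_trans (leq_add (size_polyC_leq1 _) (leqnn _))).
Qed.

Let topD (S : nzRingType) (p q : {poly S}) a c1 c2 :
    (size p <= a.+1)%N /\ p`_a = c1 -> (size q <= a.+1)%N /\ q`_a = c2 ->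
  (size (p + q)%R <= a.+1)%N /\ (p + q)`_a = c1 + c2.
Proof.
move=> [sp <-] [sq <-]; split; last by rewrite coefD.
by rewrite (leq_trans (size_polyD _ _)) // geq_max sp.
Qed.

Let cut_ge i : (j <= cut i)%N. Proof. by rewrite /cut; case: ifP. Qed.
Let cut_le i : (cut i <= j.+1)%N. Proof. by rewrite /cut; case: ifP. Qed.

Let T_slope (i : 'I_n) : (phi i j.+1 + 2 * i0 = phi i j + T + 2 * i)%N.
Proof. by rewrite /T !phiS // addKn; lia. Qed.

(** Makes the truncated subtraction in [b] exact. *)
Let T_le (i : 'I_n) l : (j <= l < d)%N -> (T <= phi i l.+1)%N.
Proof.
move=> /andP[le_jl lt_ld].
have : (phi i j.+1 <= phi i l.+1)%N by apply: leq_phi; rewrite ltnS le_jl.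
have : (2 * n <= phi i j)%N by rewrite /phi -addnA leq_addr.
have := T_slope i; have := ltn_ord i0; lia.
Qed.

Let T_lt (i : 'I_n) l : (l < j)%N -> (phi i l + T < phi i l.+1)%N.
Proof.
move=> lt_lj; have := @phi_slope n d i i0 l j; rewrite lt_lj lt_jd => /(_ isT).
by rewrite -/T; lia.
Qed.

Let T_gt (i : 'I_n) l : (j < l < d)%N -> (phi i l.+1 < phi i l + T)%N.
Proof.
move=> lt_jl; have := @phi_slope n d i0 i j l lt_jl; rewrite -/T.
by have := @leq_phi n d i l l.+1; lia.
Qed.

(** From the cut on, [b i l] stays below degree [phi i l] because the slope at [l] is less than [T]:
    by concavity if [j < l], by [i < i0] if [l = j]. *)
Let top_first (i : 'I_n) (l : 'I_d.+1) (p := if (l < d)%N then b i l else 0) :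
  (size p <= (phi i l).+1)%N /\
  p`_(phi i l) = if (l < cut i)%N then V i l else 0.
Proof.
rewrite {}/p /b; have [lt_l|le_l] := ltnP l (cut i).
  have -> : (l < d)%N by have := cut_le i; lia.
  by have := @top_monomial _ (V i l) _ _ (leqnn (phi i l)); rewrite eqxx.
case: ifP => [lt_ld|_]; last by rewrite size_poly0 coef0.
have lt_phi : (phi i l.+1 - T < phi i l)%N.
  have le_jl : (j <= l)%N by have := cut_ge i; lia.
  have := @T_le i l; rewrite le_jl lt_ld => /(_ isT).
  have := @T_gt i l; rewrite lt_ld andbT.
  move: le_l; rewrite /cut; have := T_slope i.
  case: (ltnP j l) => [_|le_lj]; first by lia.
  have -> : l = j :> nat by lia.
  by case: (leqP i0 i); lia.
have := @top_monomial _ (V i l.+1) _ _ (ltnW lt_phi).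
by rewrite (ltn_eqF lt_phi).
Qed.

(** Up to the cut, the degree [T + phi i l.-1] reaches [phi i l] only if [l.-1 = j] and [i = i0];
    there the variable [V i0 j] appears a second time. *)
Let top_second (i : 'I_n) (l : 'I_d.+1)
    (p := if (0 < l)%N then 'X^T * b i l.-1 else 0) :
  (size p <= (phi i l).+1)%N /\
  p`_(phi i l) = if (cut i < l)%N then V i l else
    if (l == cut i :> nat) && (i == i0) then V i j else 0.
Proof.
rewrite {}/p /b; case: ifP => [lt_0l|/negbT]; last first.
  rewrite -eqn0Ngt => /eqP l0; rewrite size_poly0 coef0 l0; split=> //.
  by rewrite ltn0; case: (i =P i0) => [->|_]; rewrite ?andbF // /cut leqnn.
have [l' lE] : exists l', l = l'.+1 :> nat by exists l.-1; rewrite prednK.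
have lt_l'd : (l' < d)%N by have := ltn_ord l; rewrite lE ltnS.
rewrite lE /=; case: (ltnP l' (cut i)) => [lt_l'|le_l']; rewrite mulrCA -exprD.
  rewrite [(cut i < l'.+1)%N]ltnNge lt_l' /=.
  have [eq_l'j|ne_l'j] := eqVneq l' j.
    have le_i0 : (i0 <= i)%N.
      by move: lt_l'; rewrite /cut eq_l'j; case: (leqP i0 i) => //; rewrite ltnn.
    have eq_top : (T + phi i j == phi i j.+1)%N = (i == i0).
      by have := T_slope i; rewrite -val_eqE /=; move: (phi i j) (phi i j.+1) => x y; lia.
    have le_top : (T + phi i j <= phi i j.+1)%N by have := T_slope i; lia.
    rewrite eq_l'j /cut le_i0 eqxx /=.
    by have := @top_monomial _ (V i j) _ _ le_top; rewrite eq_top; case: (i == i0).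
  have lt_l'j : (l' < j)%N by have := cut_le i; lia.
  have lt_top : (T + phi i l' < phi i l'.+1)%N by rewrite addnC T_lt.
  have -> : (l'.+1 == cut i) && (i == i0) = false.
    by apply/negP => /andP[/eqP l'E /eqP eq_i]; move: l'E; rewrite /cut eq_i leqnn; lia.
  by have := @top_monomial _ (V i l') _ _ (ltnW lt_top); rewrite (ltn_eqF lt_top).
have le_T : (T <= phi i l'.+1)%N by apply: T_le; have := cut_ge i; lia.
rewrite subnKC //.
by have := @top_monomial _ (V i l'.+1) _ _ (leqnn (phi i l'.+1)); rewrite eqxx ltnS le_l'.
Qed.

Let top_h (i : 'I_n) (l : 'I_d.+1) :
  (size (h i l) <= (phi i l).+1)%N /\ (h i l)`_(phi i l) = lambda i l.
Proof.
have -> : lambda i l = (if (l < cut i)%N then V i l else 0) +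
    (if (cut i < l)%N then V i l else
       if (l == cut i :> nat) && (i == i0) then V i j else 0).
  by rewrite /lambda; case: ltngtP; rewrite ?addr0 ?add0r.
exact: topD (top_first i l) (top_second i l).
Qed.

Let hv (v : 'I_N) : {poly R} := mxvec (\matrix_(i < n, l < d.+1) h i l) 0 v.
Let lam (v : 'I_N) : R := mxvec (\matrix_(i < n, l < d.+1) lambda i l) 0 v.

Let hvE i l : hv (mxvec_index i l) = h i l.
Proof. by rewrite /hv mxvecE mxE. Qed.

Let lamE i l : lam (mxvec_index i l) = lambda i l.
Proof. by rewrite /lam mxvecE mxE. Qed.

Let v0 : 'I_N := mxvec_index i0 (inord j).
Let v1 : 'I_N := mxvec_index i0 (inord j.+1).

Let lt_j : (j < d.+1)%N. Proof. exact: leqW. Qed.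

Let lam_v0 : lam v0 = 'X_v0.
Proof.
rewrite /v0 lamE /lambda inordK // /cut leqnn.
by rewrite ltn_eqF.
Qed.

Let lam_v1 : lam v1 = 'X_v0.
Proof. by rewrite /v1 lamE /lambda inordK // /cut leqnn eqxx /= eqxx. Qed.

Let neq_v01 : v0 != v1.
Proof.
apply/eqP => /mxvec_index_inj[_ /(congr1 val)].
by rewrite /= !inordK // => /eqP; rewrite ltn_eqF.
Qed.

Let lam_cases v : v != v1 -> lam v = 'X_v \/ lam v = 0.
Proof.
case/mxvec_indexP: v => i l ne_v; rewrite lamE /lambda inord_val.
case: eqP => [lE|_]; [right|by left].
case: eqP => // eq_i; case/eqP: ne_v.
by rewrite eq_i /v1 -(inord_val l) lE eq_i /cut leqnn.
Qed.

Let merge (u : 'X_{1..N}) : 'X_{1..N} :=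
  [multinom if x == v1 then 0%N else if x == v0 then (u v0 + u v1)%N else u x | x < N].

Let mmap1_lam u :
  mmap1 lam u = if [exists v, (lam v == 0) && (0 < u v)%N] then 0 else 'X_[merge u].
Proof.
case: ifP => [/existsP[v /andP[/eqP lam0 u_v]]|/negbT].
  by rewrite /mmap1 (bigD1 v) //= lam0 expr0n eqn0Ngt u_v mul0r.
rewrite negb_exists => /forallP good; rewrite mpolyXE_id /mmap1.
rewrite (bigD1 v0) // (bigD1 v1) 1?eq_sym //= [RHS](bigD1 v0) // [X in _ = _ * X](bigD1 v1) 1?eq_sym //=.
rewrite !mnmE eqxx (negPf neq_v01) eqxx expr0 mul1r lam_v0 lam_v1 mulrA -exprD.
congr (_ * _); apply: eq_bigr => v /andP[ne_v0 ne_v1].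
rewrite mnmE (negPf ne_v0) (negPf ne_v1); have := good v.
have [->//|->] := lam_cases ne_v1.
by rewrite eqxx /= -leqNgt leqn0 => /eqP->.
Qed.

Let weight := @avar_weight n d.

(** Merging only forgets how a total exponent is shared between [v0] and [v1]; the weight recovers
    this, [v1] being heavier. *)
Let merge_inj u u' : mwt weight u = mwt weight u' -> merge u = merge u' -> u = u'.
Proof.
move=> eq_w /mnmP eq_merge.
have eq_other x : x != v0 -> x != v1 -> u x = u' x.
  by move=> ne0 ne1; have := eq_merge x; rewrite !mnmE (negPf ne0) (negPf ne1).
have eq_sum : (u v0 + u v1 = u' v0 + u' v1)%N.
  by have := eq_merge v0; rewrite !mnmE (negPf neq_v01) eqxx.
have w01 : (weight v0 < weight v1)%N.
  rewrite /weight !avar_weightE !inordK // phiS //.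
  rewrite -[X in (X < _)%N]addn0 ltn_add2l addn_gt0 muln_gt0.
  by rewrite (leq_ltn_trans _ (ltn_ord i0)) //=; apply/orP; left; lia.
have eq1 : u v1 = u' v1.
  move: eq_w; rewrite /mwt (bigD1 v0) // (bigD1 v1) 1?eq_sym //=.
  rewrite [RHS](bigD1 v0) // [X in _ = (_ + X)%N](bigD1 v1) 1?eq_sym //=.
  rewrite (eq_bigr (fun v => u' v * weight v)%N) => [|v /andP[ne0 ne1]]; last first.
    by rewrite eq_other.
  rewrite !addnA => /addIn; nia.
apply/mnmP => x; have [->//|ne1] := eqVneq x v1.
have [->|ne0] := eqVneq x v0; last exact: eq_other.
by move: eq_sum; rewrite eq1 => /addIn.
Qed.

(** The coefficient of [f g = 0] at [W] is the weight-[W] part of [g] evaluated at [lam]. The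
    conditions on [m] keep it from being killed, and [merge_inj] keeps it apart from the other
    monomials. *)
Lemma no_ascent_coeff0 W (g : R) (m : 'X_{1..N}) :
    @resultant_ideal K n d g -> below weight W.+1 g -> mwt weight m = W ->
    (forall i : 'I_n, (i < i0)%N -> m (mxvec_index i (inord j)) = 0%N) ->
    (forall i : 'I_n, (i0 < i)%N -> m (mxvec_index i (inord j.+1)) = 0%N) ->
  g@_m = 0.
Proof.
move=> Ig bg mW m_lt m_gt.
pose f : {rmorphism R -> {poly R}} := mmap (polyC \o @mpolyC N K) hv.
have f0 : f g = 0.
  apply: (@resultant_kernel K n d {poly R} f (- 'X^T) b) Ig => i l.
  by rewrite /f /= mmapX mmap1U hvE /h; case: ifP => _; case: ifP => _; rewrite ?oppr0 ?mulNr ?opprK.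
have top_hv v : (size (hv v) <= (weight v).+1)%N /\ (hv v)`_(weight v) = lam v.
  case/mxvec_indexP: v => i l; rewrite hvE lamE /weight avar_weightE.
  exact: top_h.
have sum0 : \sum_(u <- msupp g | mwt weight u == W) (g@_u)%:MP_[N] * mmap1 lam u = 0.
  have := coef_mmap_top (@mpolyC N K) (fun v => (top_hv v).1) bg.
  rewrite -/(f g) f0 coef0 => sumE; rewrite [RHS]sumE; apply: eq_bigr => u _; congr (_ * _).
  by apply: mmap1_eq => v; rewrite (top_hv v).2.
have good_m : [exists v, (lam v == 0) && (0 < m v)%N] = false.
  apply/negbTE; rewrite negb_exists; apply/forallP => v.
  case/mxvec_indexP: v => i l; rewrite lamE /lambda.
  have X_neq0 u : 'X_[u] != 0 :> R.
    by apply/eqP => /(congr1 (mcoeff u)); rewrite mcoeffX eqxx mcoeff0 => /eqP; rewrite oner_eq0.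
  case: (nat_of_ord l =P cut i) => [lE|_] /=; last by rewrite (negPf (X_neq0 _)).
  have [_|ne_i] := eqVneq i i0; first by rewrite (negPf (X_neq0 _)).
  rewrite eqxx -eqn0Ngt -(inord_val l) lE /cut; apply/eqP.
  by case: ltngtP ne_i => [/m_gt|/m_lt|/val_inj->] //; rewrite eqxx.
apply/eqP/negP => /negP; rewrite -mcoeff_msupp => m_g.
move/(congr1 (mcoeff (merge m))): sum0; rewrite raddf_sum mcoeff0 /=.
rewrite -big_filter (bigD1_seq m) ?filter_uniq ?msupp_uniq ?mem_filter ?mW ?eqxx //=.
rewrite mmap1_lam good_m mcoeffCM mcoeffX eqxx mulr1.
rewrite big1_seq => [|u /andP[ne_um]].
  by rewrite addr0 => /eqP; apply/negP; rewrite -mcoeff_msupp.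
rewrite mem_filter => /andP[/eqP uW _].
rewrite mcoeffCM mmap1_lam; case: ifP => _; first by rewrite mcoeff0 mulr0.
rewrite mcoeffX; case: eqP => [/merge_inj eq_um|_]; last by rewrite mulr0.
by case/eqP: ne_um; apply: eq_um; rewrite uW mW.
Qed.

End NoAscent.


(** * Reduction of the top weight by minors *)

Lemma top_monomial_ascent (K : closedFieldType) (n d W : nat)
    (g : {mpoly K[n * d.+1]}) (m : 'X_{1..n * d.+1}) (l : nat) :
    (0 < n)%N -> (l < d)%N -> @resultant_ideal K n d g ->
    below (@avar_weight n d) W.+1 g -> m \in msupp g ->
    mwt (@avar_weight n d) m = W ->
  exists i i' : 'I_n, [/\ (i < i')%N, (0 < m (mxvec_index i (inord l : 'I_d.+1)))%N
    & (0 < m (mxvec_index i' (inord l.+1 : 'I_d.+1)))%N].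
Proof.
move=> n_gt0 lt_ld Ig bg m_g mW.
set occ := fun (j : nat) (i : 'I_n) => (0 < m (mxvec_index i (inord j : 'I_d.+1)))%N.
suff /existsP[i /existsP[i' /and3P[lt_ii' oi oi']]] :
    [exists i : 'I_n, [exists i' : 'I_n, [&& (i < i')%N, occ l i & occ l.+1 i']]] by exists i, i'.
apply: contraLR m_g => /existsPn no_ascent.
(* The last row with letter [l.+1] serves as [i0], since an earlier row with letter [l] would give
   an ascent. Without such a row, row 0 makes the first condition empty. *)
have [i0 [lt0 gt0]] : exists i0 : 'I_n, (forall i : 'I_n, (i < i0)%N -> ~~ occ l i) /\
    (forall i : 'I_n, (i0 < i)%N -> ~~ occ l.+1 i).
  case: (pickP (occ l.+1)) => [i1 occ1|none]; last first.
    by exists (Ordinal n_gt0); split=> // i _; rewrite none.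
  case: (arg_maxnP (fun i : 'I_n => nat_of_ord i) occ1) => i0 occ0 max0.
  exists i0; split=> i lt_i.
    by have /existsPn/(_ i0) := no_ascent i; rewrite lt_i occ0 andbT.
  by apply: contraTN lt_i => /max0; rewrite -leqNgt.
rewrite -mcoeff_eq0; apply/eqP.
apply: (no_ascent_coeff0 lt_ld Ig bg mW) => i.
  by move/lt0; rewrite -eqn0Ngt => /eqP.
by move/gt0; rewrite -eqn0Ngt => /eqP.
Qed.

Definition minor_ideal (K : closedFieldType) (n d : nat) : coef_ring K n d -> Prop :=
  ideal_gen (fun m : coef_ring K n d =>
               exists k : nat, (1 <= k <= d)%N /\ maximal_minor k m).

Lemma minor_ideal_resultant (K : closedFieldType) (n d : nat) (g : coef_ring K n d) :
  minor_ideal g -> resultant_ideal g.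
Proof.
move=> [m [c [s [Ss ->]]]]; rewrite /resultant_ideal rmorph_sum.
apply: ideal_gen_sum => t _; rewrite rmorphM; apply: ideal_genM.
have [k [/andP[k_gt0 _] Sk]] := Ss t.
by apply: (maximal_minor_resultant _ Sk); rewrite addn_gt0 k_gt0 orbT.
Qed.

(** Each heavy [m] equals, up to lighter terms, a minor times ['X_[m - p]]. The induction is on the
    list [r] with [g] fixed, because ascents come from the membership of [g] as a whole. *)
Lemma heavy_monomials_reduce (K : closedFieldType) (n d W : nat)
    (g : {mpoly K[n * d.+1]}) (r : seq 'X_{1..n * d.+1}) :
    (0 < n)%N -> (0 < d)%N -> @resultant_ideal K n d g ->
    below (@avar_weight n d) W.+1 g ->
    {subset r <= [pred m in msupp g | mwt (@avar_weight n d) m == W]} ->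
  exists2 q : coef_ring K n d, minor_ideal q &
    below (@avar_weight n d) W (\sum_(m <- r) g@_m *: 'X_[m] - q).
Proof.
move=> n_gt0 d_gt0 Ig bg; elim: r => [|m r IHr] sub_r.
  by exists 0; [apply: ideal_gen0 | rewrite big_nil subr0; apply: below0].
have [u r_u|q Jq bq] := IHr; first by apply: sub_r; rewrite inE r_u orbT.
have /andP[m_g /eqP mW] := sub_r m (mem_head _ _).
have [k [D [p [k_bound Dk le_pm bD]]]] := bad_monomial_minor K d_gt0
  (fun l lt_ld => top_monomial_ascent n_gt0 lt_ld Ig bg m_g mW).
exists (g@_m *: (D * 'X_[m - p] : {mpoly K[n * d.+1]}) + q).
  apply: ideal_genD Jq; rewrite -mul_mpolyC mulrCA mulrC.
  by apply/ideal_genM/ideal_gen_mem; exists k.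
rewrite big_cons opprD addrACA; apply: belowD bq.
rewrite -scalerBr; apply: belowZ.
have mE : m = (p + (m - p))%MM by rewrite addmC submK.
rewrite [X in 'X_[X] - _]mE mpolyXD -mulrBl -mW [X in below _ (_ X)]mE mwtD.
by apply: belowMX; rewrite -opprB; apply: belowN.
Qed.

(** Induction on the weight bound: subtracting an element of the minor ideal that cancels weight [W]
    stays inside the resultant ideal, since the minors belong to it. *)
Lemma resultant_minor_ideal (K : closedFieldType) (n d W : nat)
    (g : {mpoly K[n * d.+1]}) :
    (0 < n)%N -> (0 < d)%N -> below (@avar_weight n d) W g ->
  @resultant_ideal K n d g -> @minor_ideal K n d g.
Proof.
move=> n_gt0 d_gt0; elim: W g => [|W IHW] g bg Ig.
  have -> : g = 0; last exact: ideal_gen0.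
  apply/mpolyP => m; rewrite mcoeff0; apply/eqP/negP => /negP /bg.
  by rewrite ltn0.
pose heavy m := mwt (@avar_weight n d) m == W.
have [|q Jq bq] := @heavy_monomials_reduce K n d W g
  [seq m <- msupp g | heavy m] n_gt0 d_gt0 Ig bg.
  by move=> m; rewrite mem_filter andbC.
rewrite -[g](subrK q); apply: ideal_genD (Jq); apply: IHW.
  rewrite {1}(mpolyE g) (bigID heavy) /= addrAC -big_filter.
  apply: belowD bq _; rewrite big_seq_cond; apply: below_sum => m.
  rewrite mcoeff_msupp => /andP[/bg le_mW ne_mW]; apply/belowZ/belowX.
  by rewrite ltn_neqAle ne_mW.
rewrite /resultant_ideal rmorphB; apply: ideal_genD => //.
by rewrite -mulN1r; apply: ideal_genM; apply: (minor_ideal_resultant Jq).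
Qed.

Theorem theorem4 (K : closedFieldType) (n d : nat)
    (hn : (1 < n)%N) (hd : (1 < d)%N) (g : coef_ring K n d) :
  resultant_ideal g <->
  ideal_gen (fun m : coef_ring K n d =>
               exists k : nat, (1 <= k <= d)%N /\ maximal_minor k m) g.
Proof.
split; last exact: minor_ideal_resultant.
pose W := (\max_(m <- msupp (g : {mpoly K[n * d.+1]})) mwt (@avar_weight n d) m).+1.
apply: (@resultant_minor_ideal K n d W) (ltnW hn) (ltnW hd) _ => m.
by rewrite -mcoeff_msupp ltnS => m_g; apply: leq_bigmax_seq.
Qed.
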